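(* Let $n\ge2$, let $G_n$ be a group, let $\phi:TVB_n\to G_n$ be a representation (group homomorphism) of the twisted virtual braid group, let $\mathbb{K}$ be a field and let $a,b,c\in\mathbb{K}$. Then the map $\Phi_{a,b,c}:STVB_n\to\mathbb{K}[G_n]$ defined on generators by $$\Phi_{a,b,c}(\sigma_i^{\pm1})=\phi(\sigma_i^{\pm1}),\quad \Phi_{a,b,c}(\rho_i)=\phi(\rho_i),\quad \Phi_{a,b,c}(\tau_i)=a\,\phi(\sigma_i)+b\,\phi(\sigma_i^{-1})+c\,e\quad(1\le i\le n-1),$$ $$\Phi_{a,b,c}(\gamma_j)=\phi(\gamma_j)\quad(1\le j\le n),$$ where $e$ is the identity of $G_n$, extends to a well-defined representation of $STVB_n$, i.e. a monoid homomorphism from $STVB_n$ to the multiplicative monoid of the group algebra $\mathbb{K}[G_n]$.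
   Context: The singular twisted virtual braid monoid $STVB_n$ is the monoid with identity $e$, generators $\sigma_i,\sigma_i^{-1},\rho_i,\tau_i$ ($1\le i\le n-1$) and $\gamma_i$ ($1\le i\le n$), and the following defining relations (for all indices for which they make sense): (1) $\sigma_i\sigma_i^{-1}=\sigma_i^{-1}\sigma_i=e$, $\rho_i^2=e$, $\gamma_i^2=e$; (2) for $|i-j|>1$: $\sigma_i\sigma_j=\sigma_j\sigma_i$, $\rho_i\rho_j=\rho_j\rho_i$, $\sigma_i\rho_j=\rho_j\sigma_i$, $\tau_i\tau_j=\tau_j\tau_i$, $\sigma_i\tau_j=\tau_j\sigma_i$, $\tau_i\rho_j=\rho_j\tau_i$; (3) for $1\le i\le n-2$: $\sigma_i\sigma_{i+1}\sigma_i=\sigma_{i+1}\sigma_i\sigma_{i+1}$, $\rho_i\rho_{i+1}\rho_i=\rho_{i+1}\rho_i\rho_{i+1}$, $\rho_i\sigma_{i+1}\rho_i=\rho_{i+1}\sigma_i\rho_{i+1}$, $\rho_i\tau_{i+1}\rho_i=\rho_{i+1}\tau_i\rho_{i+1}$, $\sigma_i\sigma_{i+1}\tau_i=\tau_{i+1}\sigma_i\sigma_{i+1}$, $\sigma_{i+1}\sigma_i\tau_{i+1}=\tau_i\sigma_{i+1}\sigma_i$; (4) $\sigma_i\tau_i=\tau_i\sigma_i$ for $1\le i\le n-1$; (5) $\gamma_i\gamma_j=\gamma_j\gamma_i$ for $1\le i,j\le n$; and for $j\ne i,i+1$: $\gamma_j\rho_i=\rho_i\gamma_j$, $\gamma_j\sigma_i=\sigma_i\gamma_j$,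 $\gamma_j\tau_i=\tau_i\gamma_j$; (6) for $1\le i\le n-1$: $\gamma_{i+1}\rho_i=\rho_i\gamma_i$, $\rho_i\sigma_i\rho_i=\gamma_{i+1}\gamma_i\sigma_i\gamma_i\gamma_{i+1}$, $\rho_i\tau_i\rho_i=\gamma_{i+1}\gamma_i\tau_i\gamma_i\gamma_{i+1}$. The twisted virtual braid group $TVB_n$ is the group generated by $\sigma_i,\rho_i$ ($1\le i\le n-1$) and $\gamma_i$ ($1\le i\le n$) subject to the following defining relations (for all indices for which they make sense): $\rho_i^2=e$ and $\gamma_i^2=e$; for $|i-j|>1$: $\sigma_i\sigma_j=\sigma_j\sigma_i$, $\rho_i\rho_j=\rho_j\rho_i$, $\sigma_i\rho_j=\rho_j\sigma_i$; for $1\le i\le n-2$: $\sigma_i\sigma_{i+1}\sigma_i=\sigma_{i+1}\sigma_i\sigma_{i+1}$, $\rho_i\rho_{i+1}\rho_i=\rho_{i+1}\rho_i\rho_{i+1}$, $\rho_i\sigma_{i+1}\rho_i=\rho_{i+1}\sigma_i\rho_{i+1}$; $\gamma_i\gamma_j=\gamma_j\gamma_i$ for $1\le i,j\le n$; for $j\ne i,i+1$: $\gamma_j\rho_i=\rho_i\gamma_j$, $\gamma_j\sigma_i=\sigma_i\gamma_j$; and for $1\le i\le n-1$: $\gamma_{i+1}\rho_i=\rho_i\gamma_i$, $\rho_i\sigma_i\rho_i=\gamma_{i+1}\gamma_i\sigma_i\gamma_i\gamma_{i+1}$. *)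

(* Defs.v *)
From HB Require Import structures.
From mathcomp Require Import all_boot all_order all_algebra.
From mathcomp.classical Require Import boolp.
From mathcomp Require Import finmap.
From mathcomp.multinomials Require Import monalg.

Set Implicit Arguments.
Unset Strict Implicit.
Unset Printing Implicit Defensive.

Import GRing.Theory.
Local Open Scope quotient_scope.

(* Monoid presented by generators X and relations u = v for R u v: the       *)
(* quotient of the free monoid of words over X by the congruence generated   *)
(* by R. The congruence is in general undecidable, so the quotient type is   *)
(* formed with the classical truth value `[< _ >].                           *)
Section MonoidPresentation.
Context (X : choiceType) (R : seq X -> seq X -> Prop).

Inductive word_cong : seq X -> seq X -> Prop :=
| word_cong_rel u v : R u v -> word_cong u v
| word_cong_refl u : word_cong u u
| word_cong_sym u v : word_cong u v -> word_cong v u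
| word_cong_trans u v w : word_cong u v -> word_cong v w -> word_cong u w
| word_cong_cat u u' v v' :
    word_cong u u' -> word_cong v v' -> word_cong (u ++ v) (u' ++ v').

Definition word_eqv : rel (seq X) := fun u v => `[< word_cong u v >].

Lemma word_eqv_refl : reflexive word_eqv.
Proof. by move=> u; apply/asboolP; apply: word_cong_refl. Qed.

Lemma word_eqv_sym : symmetric word_eqv.
Proof. by move=> u v; apply/asboolP/asboolP; apply: word_cong_sym. Qed.

Lemma word_eqv_trans : transitive word_eqv.
Proof.
by move=> v u w /asboolP uv /asboolP vw; apply/asboolP; apply: word_cong_trans vw.
Qed.

Canonical word_equiv :=
  EquivRel word_eqv word_eqv_refl word_eqv_sym word_eqv_trans.

Definition pres_monoid := {eq_quot word_eqv}.

HB.instance Definition _ := Choice.on pres_monoid.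
HB.instance Definition _ := EqQuotient.on pres_monoid.

Definition pres_word (w : seq X) : pres_monoid := \pi w.

Definition pres_mul (x y : pres_monoid) : pres_monoid :=
  pres_word (repr x ++ repr y).

Lemma pres_wordP u v : pres_word u = pres_word v <-> word_cong u v.
Proof.
split=> [/eqmodP/asboolP //|uv]; by apply/eqmodP/asboolP.
Qed.

Lemma pres_mul_word u v : pres_mul (pres_word u) (pres_word v) = pres_word (u ++ v).
Proof.
by apply/pres_wordP/word_cong_cat; apply/pres_wordP; rewrite /pres_word reprK.
Qed.

Lemma pres_word_repr x : pres_word (repr x) = x.
Proof. exact: reprK. Qed.

Lemma pres_mulA : associative pres_mul.
Proof.
move=> x y z; rewrite -(pres_word_repr x) -(pres_word_repr y) -(pres_word_repr z).
by rewrite !pres_mul_word catA.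
Qed.

Lemma pres_mul1g : left_id (pres_word [::]) pres_mul.
Proof. by move=> x; rewrite -[x]pres_word_repr pres_mul_word. Qed.

Lemma pres_mulg1 : right_id (pres_word [::]) pres_mul.
Proof. by move=> x; rewrite -[x]pres_word_repr pres_mul_word cats0. Qed.

HB.instance Definition _ :=
  isMonoid.Build pres_monoid pres_mulA pres_mul1g pres_mulg1.

Definition pres_gen (x : X) : pres_monoid := pres_word [:: x].

Lemma pres_wordM u v : (pres_word u * pres_word v)%g = pres_word (u ++ v).
Proof. exact: pres_mul_word. Qed.

End MonoidPresentation.

(* Group presented by generators X and relations u = v for R u v, where u, v *)
(* are words in the signed letters (x, false), standing for x, and           *)
(* (x, true), standing for x^-1.                                             *)
Section GroupPresentation.
Context (X : choiceType) (R : seq (X * bool) -> seq (X * bool) -> Prop).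

Inductive group_rel : seq (X * bool) -> seq (X * bool) -> Prop :=
| group_rel_rel u v : R u v -> group_rel u v
| group_rel_cancel x b : group_rel [:: (x, b); (x, ~~ b)] [::].

Definition pres_group := pres_monoid group_rel.

HB.instance Definition _ := Monoid.on pres_group.

Definition flip_letter (l : X * bool) := (l.1, ~~ l.2).

Definition inv_word (w : seq (X * bool)) := rev (map flip_letter w).

Definition pres_inv (x : pres_group) : pres_group :=
  pres_word group_rel (inv_word (repr x)).

Lemma flip_letterK : involutive flip_letter.
Proof. by case=> x b; rewrite /flip_letter /= negbK. Qed.

Lemma inv_wordK : involutive inv_word.
Proof.
move=> w; rewrite /inv_word map_rev revK -map_comp.
by rewrite (eq_map (g := id)) ?map_id // => l; apply: flip_letterK.
Qed.

Lemma word_cong_inv w : word_cong group_rel (w ++ inv_word w) [::].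
Proof.
elim: w => [|[x b] w IHw]; first exact: word_cong_refl.
have ->: ((x, b) :: w) ++ inv_word ((x, b) :: w) =
    [:: (x, b)] ++ ((w ++ inv_word w) ++ [:: flip_letter (x, b)]).
  by rewrite /inv_word /= rev_cons -cats1 catA.
apply: (@word_cong_trans _ _ _ ([:: (x, b)] ++ ([::] ++ [:: flip_letter (x, b)]))).
  apply: word_cong_cat (word_cong_refl _ _) _.
  exact: word_cong_cat IHw (word_cong_refl _ _).
exact/word_cong_rel/group_rel_cancel.
Qed.

Lemma pres_mulgV : right_inverse (1%g : pres_group) pres_inv *%g.
Proof.
move=> x; rewrite -[X in (X * _)%g]pres_word_repr pres_wordM.
by apply/pres_wordP/word_cong_inv.
Qed.

Lemma pres_mulVg : left_inverse (1%g : pres_group) pres_inv *%g.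
Proof.
move=> x; rewrite -[X in (_ * X)%g]pres_word_repr pres_wordM.
by apply/pres_wordP; rewrite -{2}(inv_wordK (repr x)); apply: word_cong_inv.
Qed.

HB.instance Definition _ := hasInv.Build pres_group pres_inv.
HB.instance Definition _ := Monoid_isGroup.Build pres_group pres_mulVg pres_mulgV.

Definition pres_group_gen (x : X) : pres_group := pres_gen group_rel (x, false).

End GroupPresentation.

(* Indices are shifted to start at 0: sigma_i, rho_i, tau_i (1 <= i <= n-1)  *)
(* are indexed by 'I_n.-1 and gamma_j (1 <= j <= n) by 'I_n. In the          *)
(* relations, index equations such as j = i + 1 are taken in nat.            *)

Inductive tvb_gen (n : nat) :=
| TVBsigma of 'I_n.-1
| TVBrho of 'I_n.-1
| TVBgamma of 'I_n.

HB.instance Definition _ n := gen_eqMixin (tvb_gen n).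
HB.instance Definition _ n := gen_choiceMixin (tvb_gen n).

Section TVB.
Context (n : nat).

Local Notation s i := (TVBsigma i, false).
Local Notation r i := (TVBrho i, false).
Local Notation g j := (TVBgamma j, false).

Inductive tvb_rel : seq (tvb_gen n * bool) -> seq (tvb_gen n * bool) -> Prop :=
| tvb_rr i : tvb_rel [:: r i; r i] [::]
| tvb_gg j : tvb_rel [:: g j; g j] [::]
| tvb_ss_far (i j : 'I_n.-1) : (1 < `|i - j|)%N ->
    tvb_rel [:: s i; s j] [:: s j; s i]
| tvb_rr_far (i j : 'I_n.-1) : (1 < `|i - j|)%N ->
    tvb_rel [:: r i; r j] [:: r j; r i]
| tvb_sr_far (i j : 'I_n.-1) : (1 < `|i - j|)%N ->
    tvb_rel [:: s i; r j] [:: r j; s i]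
| tvb_sss (i j : 'I_n.-1) : j = i.+1 :> nat ->
    tvb_rel [:: s i; s j; s i] [:: s j; s i; s j]
| tvb_rrr (i j : 'I_n.-1) : j = i.+1 :> nat ->
    tvb_rel [:: r i; r j; r i] [:: r j; r i; r j]
| tvb_rsr (i j : 'I_n.-1) : j = i.+1 :> nat ->
    tvb_rel [:: r i; s j; r i] [:: r j; s i; r j]
| tvb_gg_comm (i j : 'I_n) : tvb_rel [:: g i; g j] [:: g j; g i]
| tvb_gr_far (i : 'I_n.-1) (j : 'I_n) : j <> i :> nat -> j <> i.+1 :> nat ->
    tvb_rel [:: g j; r i] [:: r i; g j]
| tvb_gs_far (i : 'I_n.-1) (j : 'I_n) : j <> i :> nat -> j <> i.+1 :> nat ->
    tvb_rel [:: g j; s i] [:: s i; g j]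
| tvb_gr (i : 'I_n.-1) (j k : 'I_n) : j = i :> nat -> k = i.+1 :> nat ->
    tvb_rel [:: g k; r i] [:: r i; g j]
| tvb_rsr_g (i : 'I_n.-1) (j k : 'I_n) : j = i :> nat -> k = i.+1 :> nat ->
    tvb_rel [:: r i; s i; r i] [:: g k; g j; s i; g j; g k].

Definition TVB : Type := pres_group tvb_rel.
HB.instance Definition _ := Group.on TVB.

Definition tvb_sigma (i : 'I_n.-1) : TVB := pres_group_gen tvb_rel (TVBsigma i).
Definition tvb_rho (i : 'I_n.-1) : TVB := pres_group_gen tvb_rel (TVBrho i).
Definition tvb_gamma (j : 'I_n) : TVB := pres_group_gen tvb_rel (TVBgamma j).

End TVB.

(* STVBsigmaV i is the generator sigma_i^-1 of the monoid.                   *)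
Inductive stvb_gen (n : nat) :=
| STVBsigma of 'I_n.-1
| STVBsigmaV of 'I_n.-1
| STVBrho of 'I_n.-1
| STVBtau of 'I_n.-1
| STVBgamma of 'I_n.

HB.instance Definition _ n := gen_eqMixin (stvb_gen n).
HB.instance Definition _ n := gen_choiceMixin (stvb_gen n).

Section STVB.
Context (n : nat).

Let s := @STVBsigma n.
Let sV := @STVBsigmaV n.
Let r := @STVBrho n.
Let t := @STVBtau n.
Let g := @STVBgamma n.

Inductive stvb_rel : seq (stvb_gen n) -> seq (stvb_gen n) -> Prop :=
| stvb_ssV i : stvb_rel [:: s i; sV i] [::]
| stvb_sVs i : stvb_rel [:: sV i; s i] [::]
| stvb_rr i : stvb_rel [:: r i; r i] [::]
| stvb_gg j : stvb_rel [:: g j; g j] [::]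
| stvb_ss_far (i j : 'I_n.-1) : (1 < `|i - j|)%N ->
    stvb_rel [:: s i; s j] [:: s j; s i]
| stvb_rr_far (i j : 'I_n.-1) : (1 < `|i - j|)%N ->
    stvb_rel [:: r i; r j] [:: r j; r i]
| stvb_sr_far (i j : 'I_n.-1) : (1 < `|i - j|)%N ->
    stvb_rel [:: s i; r j] [:: r j; s i]
| stvb_tt_far (i j : 'I_n.-1) : (1 < `|i - j|)%N ->
    stvb_rel [:: t i; t j] [:: t j; t i]
| stvb_st_far (i j : 'I_n.-1) : (1 < `|i - j|)%N ->
    stvb_rel [:: s i; t j] [:: t j; s i]
| stvb_tr_far (i j : 'I_n.-1) : (1 < `|i - j|)%N ->
    stvb_rel [:: t i; r j] [:: r j; t i]
| stvb_sss (i j : 'I_n.-1) : j = i.+1 :> nat ->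
    stvb_rel [:: s i; s j; s i] [:: s j; s i; s j]
| stvb_rrr (i j : 'I_n.-1) : j = i.+1 :> nat ->
    stvb_rel [:: r i; r j; r i] [:: r j; r i; r j]
| stvb_rsr (i j : 'I_n.-1) : j = i.+1 :> nat ->
    stvb_rel [:: r i; s j; r i] [:: r j; s i; r j]
| stvb_rtr (i j : 'I_n.-1) : j = i.+1 :> nat ->
    stvb_rel [:: r i; t j; r i] [:: r j; t i; r j]
| stvb_sst (i j : 'I_n.-1) : j = i.+1 :> nat ->
    stvb_rel [:: s i; s j; t i] [:: t j; s i; s j]
| stvb_sst' (i j : 'I_n.-1) : j = i.+1 :> nat ->
    stvb_rel [:: s j; s i; t j] [:: t i; s j; s i]
| stvb_st i : stvb_rel [:: s i; t i] [:: t i; s i]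
| stvb_gg_comm (i j : 'I_n) : stvb_rel [:: g i; g j] [:: g j; g i]
| stvb_gr_far (i : 'I_n.-1) (j : 'I_n) : j <> i :> nat -> j <> i.+1 :> nat ->
    stvb_rel [:: g j; r i] [:: r i; g j]
| stvb_gs_far (i : 'I_n.-1) (j : 'I_n) : j <> i :> nat -> j <> i.+1 :> nat ->
    stvb_rel [:: g j; s i] [:: s i; g j]
| stvb_gt_far (i : 'I_n.-1) (j : 'I_n) : j <> i :> nat -> j <> i.+1 :> nat ->
    stvb_rel [:: g j; t i] [:: t i; g j]
| stvb_gr (i : 'I_n.-1) (j k : 'I_n) : j = i :> nat -> k = i.+1 :> nat ->
    stvb_rel [:: g k; r i] [:: r i; g j]
| stvb_rsr_g (i : 'I_n.-1) (j k : 'I_n) : j = i :> nat -> k = i.+1 :> nat ->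
    stvb_rel [:: r i; s i; r i] [:: g k; g j; s i; g j; g k]
| stvb_rtr_g (i : 'I_n.-1) (j k : 'I_n) : j = i :> nat -> k = i.+1 :> nat ->
    stvb_rel [:: r i; t i; r i] [:: g k; g j; t i; g j; g k].

Definition STVB : Type := pres_monoid stvb_rel.
HB.instance Definition _ := Monoid.on STVB.

Definition stvb_sigma (i : 'I_n.-1) : STVB := pres_gen stvb_rel (STVBsigma i).
Definition stvb_sigmaV (i : 'I_n.-1) : STVB := pres_gen stvb_rel (STVBsigmaV i).
Definition stvb_rho (i : 'I_n.-1) : STVB := pres_gen stvb_rel (STVBrho i).
Definition stvb_tau (i : 'I_n.-1) : STVB := pres_gen stvb_rel (STVBtau i).
Definition stvb_gamma (j : 'I_n) : STVB := pres_gen stvb_rel (STVBgamma j).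

End STVB.

(* The group algebra K[G]: finitely supported functions G -> K, with the     *)
(* convolution product. The K-module structure is that of {malg K[G]}; its   *)
(* ring structure in monalg is not available for groups, as it requires that *)
(* k1 * k2 = 1 holds only for k1 = k2 = 1.                                   *)
Section GroupAlgebra.
Local Open Scope fset_scope.
Local Open Scope ring_scope.
Context (K : fieldType) (G : groupType).

Definition group_alg : Type := {malg K[G]}.

HB.instance Definition _ := GRing.Lmodule.on group_alg.

Implicit Types x y z : group_alg.

(* The image in K[G] of a group element. *)
Definition galg_of (h : G) : group_alg := << h >>.

Definition galg_mul x y : group_alg :=
  \sum_(k1 <- msupp x) \sum_(k2 <- msupp y)
    << x@_k1 * y@_k2 *g (k1 * k2)%g >>.

Lemma galg_mullw (d1 d2 : {fset G}) x y :
  msupp x `<=` d1 -> msupp y `<=` d2 ->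
  galg_mul x y =
    \sum_(k1 <- d1) \sum_(k2 <- d2) << x@_k1 * y@_k2 *g (k1 * k2)%g >>.
Proof.
move=> le_d1 le_d2; rewrite /galg_mul (big_fset_incl _ le_d1) /=.
  apply/eq_bigr=> k1 _; apply/big_fset_incl => // k _ /mcoeff_outdom ->.
  by rewrite mulr0 monalgU0.
move=> k _ /mcoeff_outdom xk.
by rewrite big1 => // k' _; rewrite xk mul0r monalgU0.
Qed.

Lemma galg_mulDl : left_distributive galg_mul +%R.
Proof.
move=> x y z; have sz := fsubset_refl (msupp z).
rewrite (galg_mullw (fsubsetUl (msupp x) (msupp y)) sz).
rewrite (galg_mullw (fsubsetUr (msupp x) (msupp y)) sz).
rewrite (galg_mullw (msuppD_le x y) sz) -big_split /=; apply/eq_bigr=> k1 _.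
rewrite -big_split /=; apply/eq_bigr=> k2 _.
by rewrite mcoeffD mulrDl monalgUD.
Qed.

Lemma galg_mulDr : right_distributive galg_mul +%R.
Proof.
move=> z x y; have sz := fsubset_refl (msupp z).
rewrite (galg_mullw sz (fsubsetUl (msupp x) (msupp y))).
rewrite (galg_mullw sz (fsubsetUr (msupp x) (msupp y))).
rewrite (galg_mullw sz (msuppD_le x y)) -big_split /=; apply/eq_bigr=> k1 _.
rewrite -big_split /=; apply/eq_bigr=> k2 _.
by rewrite mcoeffD mulrDr monalgUD.
Qed.

Lemma galg_mul0l : left_zero 0 galg_mul.
Proof. by move=> x; rewrite /galg_mul msupp0 big_seq_fset0. Qed.

Lemma galg_mul0r : right_zero 0 galg_mul.
Proof. by move=> x; rewrite /galg_mul big1 // => k _; rewrite msupp0 big_seq_fset0. Qed.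

Lemma galg_mulUU (c1 c2 : K) (k1 k2 : G) :
  galg_mul << c1 *g k1 >> << c2 *g k2 >> = << c1 * c2 *g (k1 * k2)%g >>.
Proof. by rewrite (galg_mullw msuppU_le msuppU_le) !big_seq_fset1 !mcoeffUU. Qed.

Lemma galg_ind (P : group_alg -> Prop) :
  P 0 -> (forall x y, P x -> P y -> P (x + y)) ->
  (forall (c : K) (k : G), P << c *g k >>) -> forall x, P x.
Proof. by move=> P0 PD PU x; rewrite (monalgE x); apply: (big_ind P). Qed.

Lemma galg_mulA : associative galg_mul.
Proof.
move=> x y z; elim/galg_ind: x => [|x x' IHx IHx'|c1 k1].
- by rewrite !galg_mul0l.
- by rewrite !galg_mulDl IHx IHx'.
elim/galg_ind: y => [|y y' IHy IHy'|c2 k2].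
- by rewrite !(galg_mul0l, galg_mul0r).
- by rewrite !(galg_mulDl, galg_mulDr) IHy IHy'.
elim/galg_ind: z => [|z z' IHz IHz'|c3 k3].
- by rewrite !galg_mul0r.
- by rewrite !galg_mulDr IHz IHz'.
by rewrite !galg_mulUU mulrA mulgA.
Qed.

Lemma galg_mul1l : left_id (galg_of 1%g) galg_mul.
Proof.
elim/galg_ind => [|x y IHx IHy|c k]; first exact: galg_mul0r.
  by rewrite galg_mulDr IHx IHy.
by rewrite galg_mulUU mul1r mul1g.
Qed.

Lemma galg_mul1r : right_id (galg_of 1%g) galg_mul.
Proof.
elim/galg_ind => [|x y IHx IHy|c k]; first exact: galg_mul0l.
  by rewrite galg_mulDl IHx IHy.
by rewrite galg_mulUU mulr1 mulg1.
Qed.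

Lemma galg_oner_neq0 : galg_of 1%g != 0.
Proof. by rewrite monalgU_eq0 oner_eq0. Qed.

HB.instance Definition _ := GRing.Zmodule_isNzRing.Build group_alg
  galg_mulA galg_mul1l galg_mul1r galg_mulDl galg_mulDr galg_oner_neq0.

Lemma galg_scaleU (c d : K) (k : G) :
  c *: (<< d *g k >> : group_alg) = << c * d *g k >>.
Proof. by apply/malgP => k'; rewrite mcoeffZ !mcoeffU mulrnAr. Qed.

Lemma galg_mul_def x y : x * y = galg_mul x y.
Proof. by []. Qed.

Lemma galg_scaleAl (c : K) x y : c *: (x * y) = (c *: x) * y.
Proof.
elim/galg_ind: x => [|x x' IHx IHx'|c1 k1]; first by rewrite !(mul0r, scaler0).
  by rewrite mulrDl !scalerDr mulrDl IHx IHx'.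
elim/galg_ind: y => [|y y' IHy IHy'|c2 k2]; first by rewrite !(mulr0, scaler0).
  by rewrite !mulrDr scalerDr IHy IHy'.
by rewrite !galg_mul_def galg_scaleU !galg_mulUU galg_scaleU mulrA.
Qed.

HB.instance Definition _ :=
  GRing.Lmodule_isLalgebra.Build K group_alg galg_scaleAl.

Lemma galg_scaleAr (c : K) x y : c *: (x * y) = x * (c *: y).
Proof.
elim/galg_ind: x => [|x x' IHx IHx'|c1 k1]; first by rewrite !(mul0r, scaler0).
  by rewrite !mulrDl scalerDr IHx IHx'.
elim/galg_ind: y => [|y y' IHy IHy'|c2 k2]; first by rewrite !(mulr0, scaler0).
  by rewrite mulrDr !scalerDr mulrDr IHy IHy'.
by rewrite !galg_mul_def galg_scaleU !galg_mulUU galg_scaleU mulrCA.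
Qed.

HB.instance Definition _ :=
  GRing.Lalgebra_isAlgebra.Build K group_alg galg_scaleAr.

End GroupAlgebra.

(* Main.v *)
(* By the universal property of the presentation of STVB_n, it suffices to    *)
(* check the defining relations on the images of the generators. Relations    *)
(* without tau already hold in TVB_n. Put T(x) = a x + b x^-1 + c. If         *)
(* g x = y g in G, then also g x^-1 = y^-1 g, hence g T(x) = T(y) g in K[G].  *)
(* Every relation involving tau is, up to moving group elements from one side *)
(* to the other, of the form g tau_i = tau_j g, where g sigma_i = sigma_j g   *)
(* in TVB_n; the remaining one, tau_i tau_j = tau_j tau_i, follows by using   *)
(* linearity in both factors.                                                 *)

Require Import Defs.
From mathcomp Require Import all_boot all_order all_algebra.

Set Implicit Arguments.
Unset Strict Implicit.
Unset Printing Implicit Defensive.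

Local Open Scope ring_scope.

Import GRing.Theory.

(** Write $T(x)=ax+bx^{-1}+c$ ([galg_skein]). The key point is that $gx=yg$ in $G$ passes to
    $gT(x)=T(y)g$ in the group algebra ([galg_skein_intertwine]). Hence a $\tau$-relation $p\tau
    q=p'\tau'q'$ holds as soon as its $\sigma$-analogue does and $pq=p'q'$ ([galg_skein_sandwich]).
    The relation with two $\tau$'s needs linearity twice ([galg_skein_comm]), and [pres_monoid_lift]
    then extends the map. *)

Section PresentationLift.
Context (X : choiceType) (R : seq X -> seq X -> Prop).

Lemma pres_word_prod (w : seq X) :
  pres_word R w = (\big[*%g/1]_(x <- w) pres_gen R x)%g.
Proof.
by elim: w => [|x w IHw]; rewrite ?big_nil // big_cons -IHw pres_wordM.
Qed.

(** [F] multiplies out the letters of a chosen representative; induction on the congruence shows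
    that the choice does not matter. *)
Lemma pres_monoid_lift (A : pzSemiRingType) (f : X -> A) :
  (forall u v, R u v -> \prod_(x <- u) f x = \prod_(x <- v) f x) ->
  exists F : pres_monoid R -> A,
    [/\ F 1%g = 1, {morph F : x y / (x * y)%g >-> x * y}
      & forall x, F (pres_gen R x) = f x].
Proof.
move=> fR.
have f_cong u v : word_cong R u v -> \prod_(x <- u) f x = \prod_(x <- v) f x.
  elim=> {u v} [u v /fR //|//|u v _ -> //|u v w _ -> _ -> //|].
  by move=> u u' v v' _ Eu _ Ev; rewrite !big_cat /= Eu Ev.
have f_word w : \prod_(x <- repr (pres_word R w)) f x = \prod_(x <- w) f x.
  exact/f_cong/pres_wordP/pres_word_repr.
exists (fun m => \prod_(x <- repr m) f x); split=> [|x y|x].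
- by rewrite f_word big_nil.
- by rewrite -{1}(pres_word_repr x) -{1}(pres_word_repr y) pres_wordM f_word big_cat.
- by rewrite f_word big_seq1.
Qed.

End PresentationLift.

(** Here [p] is any algebra element, so that it can later be a combination $T(y)$ as well as a group
    element. *)
Lemma linear_comb3_intertwine (K : comNzRingType) (A : algType K) (a b c : K)
    (p x x' y y' : A) : p * x = y * p -> p * x' = y' * p ->
  p * (a *: x + b *: x' + c *: 1) = (a *: y + b *: y' + c *: 1) * p.
Proof.
by move=> px px'; rewrite !mulrDr !mulrDl -!scalerAr -!scalerAl px px' mulr1 mul1r.
Qed.

Lemma mulg_intertwineV (G : groupType) (g x y : G) :
  (g * x = y * g)%g -> (g * x^-1 = y^-1 * g)%g.
Proof. by move=> gx; apply: (mulgI y); rewrite mulVKg mulgA -gx mulgK. Qed.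

Lemma mulr_sandwich (A : pzSemiRingType) (p g q x y : A) : g * x = y * g ->
  p * g * x * q = p * y * (g * q).
Proof. by move=> gx; rewrite -(mulrA p) gx !mulrA. Qed.

Lemma gmulf1_group (G H : groupType) (f : {multiplicative G -> H}) : f 1%g = 1%g.
Proof. by apply: (mulgI (f 1%g)); rewrite -gmulfM !mulg1. Qed.

Lemma gmulfV_group (G H : groupType) (f : {multiplicative G -> H}) x :
  f x^-1%g = (f x)^-1%g.
Proof. by apply: (mulgI (f x)); rewrite -gmulfM !mulgV gmulf1_group. Qed.

Section GroupAlgebraSkein.
Context (K : fieldType) (G : groupType) (a b c : K).
Implicit Types g h x y : G.

Lemma galg_ofM g h : galg_of K (g * h)%g = galg_of K g * galg_of K h.
Proof. by rewrite galg_mul_def galg_mulUU mulr1. Qed.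

Definition galg_skein x : group_alg K G :=
  a *: galg_of K x + b *: galg_of K x^-1%g + c *: galg_of K (1%g : G).

Lemma galg_skein_intertwine g x y : (g * x = y * g)%g ->
  galg_of K g * galg_skein x = galg_skein y * galg_of K g.
Proof.
move=> gx; apply: linear_comb3_intertwine; rewrite -!galg_ofM ?gx //.
by rewrite (mulg_intertwineV gx).
Qed.

Lemma galg_skein_comm x y : (x * y = y * x)%g ->
  galg_skein x * galg_skein y = galg_skein y * galg_skein x.
Proof.
move=> xy; symmetry; apply: linear_comb3_intertwine.
  by symmetry; apply: galg_skein_intertwine.
by symmetry; apply: galg_skein_intertwine; symmetry; apply: mulg_intertwineV.
Qed.

(* The element [p'^-1 p] intertwines [x] and [y].                             *)
Lemma galg_skein_sandwich p q p' q' x y : (p * q = p' * q')%g ->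
  (p * x * q = p' * y * q')%g ->
  galg_of K p * galg_skein x * galg_of K q =
  galg_of K p' * galg_skein y * galg_of K q'.
Proof.
move=> pq pxq; have [g Ep] : exists g, p = (p' * g)%g.
  by exists (p'^-1 * p)%g; rewrite mulVKg.
have Eq' : q' = (g * q)%g by apply: (mulgI p'); rewrite mulgA -Ep.
have gx : (g * x = y * g)%g.
  apply: (mulgI p'); apply: (mulIg q).
  by rewrite mulgA -Ep pxq Eq' !mulgA.
by rewrite Ep Eq' !galg_ofM; apply: mulr_sandwich; apply: galg_skein_intertwine.
Qed.

End GroupAlgebraSkein.

Theorem mainTheorem6 (n : nat) (n_ge2 : (2 <= n)%N) (G : groupType)
    (phi : {multiplicative TVB n -> G}) (K : fieldType) (a b c : K) :
  exists Phi : STVB n -> group_alg K G,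
    [/\ Phi 1%g = 1 /\ {morph Phi : x y / (x * y)%g >-> x * y},
        forall i : 'I_n.-1,
          Phi (stvb_sigma i) = galg_of K (phi (tvb_sigma i)) /\
          Phi (stvb_sigmaV i) = galg_of K (phi (tvb_sigma i)^-1%g),
        forall i : 'I_n.-1, Phi (stvb_rho i) = galg_of K (phi (tvb_rho i)),
        forall i : 'I_n.-1,
          Phi (stvb_tau i) = a *: galg_of K (phi (tvb_sigma i))
                           + b *: galg_of K (phi (tvb_sigma i)^-1%g)
                           + c *: galg_of K (1%g : G)
      & forall j : 'I_n, Phi (stvb_gamma j) = galg_of K (phi (tvb_gamma j))].
Proof.
pose S i := phi (tvb_sigma i); pose P i := phi (tvb_rho i).
pose C j := phi (tvb_gamma j).
pose letter (l : tvb_gen n * bool) : G := phi (pres_gen _ l).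
(* Since [phi] is multiplicative, each defining relation of $TVB_n$ becomes an identity in $G$. *)
have tvbE u v : tvb_rel u v ->
    (\big[*%g/1]_(l <- u) letter l = \big[*%g/1]_(l <- v) letter l)%g.
  move=> uv; have phi_prod w :
      (\big[*%g/1]_(l <- w) letter l)%g = phi (pres_word (group_rel (@tvb_rel n)) w).
    by rewrite pres_word_prod (big_morph phi (@gmulfM _ _ phi) (gmulf1_group phi)).
  by rewrite !phi_prod; congr (phi _); apply/pres_wordP/word_cong_rel/group_rel_rel.
pose f (x : stvb_gen n) : group_alg K G := match x with
  | STVBsigma i => galg_of K (S i)
  | STVBsigmaV i => galg_of K (S i)^-1%g
  | STVBrho i => galg_of K (P i)
  | STVBtau i => galg_skein a b c (S i)
  | STVBgamma j => galg_of K (C j)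
  end.
pose letterE := (big_cons, big_nil, mulg1).
pose genE := (big_cons, big_nil, mulr1).
have ss_far (i j : 'I_n.-1) : (1 < `|i - j|)%N -> (S i * S j = S j * S i)%g.
  by move/tvb_ss_far/tvbE; rewrite !letterE.
have sr_far (i j : 'I_n.-1) : (1 < `|i - j|)%N -> (S i * P j = P j * S i)%g.
  by move/tvb_sr_far/tvbE; rewrite !letterE.
have rr i : (P i * P i = 1)%g by have := tvbE _ _ (tvb_rr i); rewrite !letterE.
have gg j : (C j * C j = 1)%g by have := tvbE _ _ (tvb_gg j); rewrite !letterE.
have sss (i j : 'I_n.-1) : j = i.+1 :> nat ->
    (S i * (S j * S i) = S j * (S i * S j))%g.
  by move/tvb_sss/tvbE; rewrite !letterE.
have rsr (i j : 'I_n.-1) : j = i.+1 :> nat ->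
    (P i * (S j * P i) = P j * (S i * P j))%g.
  by move/tvb_rsr/tvbE; rewrite !letterE.
have gs_far (i : 'I_n.-1) (j : 'I_n) : j <> i :> nat -> j <> i.+1 :> nat ->
    (C j * S i = S i * C j)%g.
  by move=> ji /(tvb_gs_far ji)/tvbE; rewrite !letterE.
have rsr_g (i : 'I_n.-1) (j k : 'I_n) : j = i :> nat -> k = i.+1 :> nat ->
    (P i * (S i * P i) = C k * (C j * (S i * (C j * C k))))%g.
  by move=> ji /(tvb_rsr_g ji)/tvbE; rewrite !letterE.
have fR u v : stvb_rel u v -> \prod_(x <- u) f x = \prod_(x <- v) f x.
  case=> {u v}.
  - by move=> i; rewrite !genE /f -galg_ofM mulgV.
  - by move=> i; rewrite !genE /f -galg_ofM mulVg.
  - by move=> i; rewrite !genE /f -galg_ofM rr.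
  - by move=> j; rewrite !genE /f -galg_ofM gg.
  - by move=> i j ij; rewrite !genE /f -!galg_ofM ss_far.
  - move=> i j /tvb_rr_far/tvbE; rewrite !letterE => E.
    by rewrite !genE /f -!galg_ofM; congr galg_of.
  - by move=> i j ij; rewrite !genE /f -!galg_ofM sr_far.
  - move=> i j ij; rewrite big_cons big_seq1 big_cons big_seq1 /f.
    by apply: galg_skein_comm; apply: ss_far.
  - by move=> i j ij; rewrite !genE /f; apply: galg_skein_intertwine; apply: ss_far.
  - move=> i j ij; rewrite !genE /f; symmetry.
    by apply: galg_skein_intertwine; rewrite sr_far.
  - by move=> i j ij; rewrite !genE /f -!galg_ofM sss.
  - move=> i j /tvb_rrr/tvbE; rewrite !letterE => E.
    by rewrite !genE /f -!galg_ofM; congr galg_of.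
  - by move=> i j ij; rewrite !genE /f -!galg_ofM rsr.
  (* Here $p=q=\rho_i$ and $p'=q'=\rho_{i+1}$ are involutions, so $pq=p'q'=e$. *)
  - move=> i j ij; rewrite !genE !mulrA; apply: galg_skein_sandwich.
      by rewrite !rr.
    by rewrite -!mulgA rsr.
  (* The braid relation says that $g=\sigma_i\sigma_{i+1}$ intertwines $\sigma_i$ with
     $\sigma_{i+1}$; the next case reads it backwards. *)
  - move=> i j ij; rewrite !genE /f -galg_ofM mulrA -galg_ofM.
    by apply: galg_skein_intertwine; rewrite -mulgA (sss i j).
  - move=> i j ij; rewrite !genE /f -galg_ofM mulrA -galg_ofM.
    by apply: galg_skein_intertwine; rewrite -mulgA -(sss i j).
  - by move=> i; rewrite !genE /f; apply: galg_skein_intertwine.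
  - move=> i j; have := tvbE _ _ (tvb_gg_comm i j); rewrite !letterE => E.
    by rewrite !genE /f -!galg_ofM; congr galg_of.
  - move=> i j ji jSi; have := tvbE _ _ (tvb_gr_far ji jSi).
    by rewrite !letterE => E; rewrite !genE /f -!galg_ofM; congr galg_of.
  - by move=> i j ji jSi; rewrite !genE /f -!galg_ofM gs_far.
  - by move=> i j ji jSi; rewrite !genE /f; apply: galg_skein_intertwine; apply: gs_far.
  - move=> i j k ji kSi; have := tvbE _ _ (tvb_gr ji kSi).
    by rewrite !letterE => E; rewrite !genE /f -!galg_ofM; congr galg_of.
  - by move=> i j k ji kSi; rewrite !genE /f -!galg_ofM (rsr_g i j k).
  (* Sandwich with $p=q=\rho_i$, $p'=\gamma_{i+1}\gamma_i$ and $q'=\gamma_i\gamma_{i+1}$; again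
     $pq=p'q'=e$. *)
  - move=> i j k ji kSi; rewrite !genE /f mulrA [RHS]mulrA -!galg_ofM [RHS]mulrA.
    apply: galg_skein_sandwich.
      by rewrite rr -mulgA (mulgA (C j)) gg mul1g gg.
    by rewrite -!mulgA (rsr_g i j k).
have [Phi [Phi1 PhiM Phi_gen]] := pres_monoid_lift fR.
(* The inverse is taken in $TVB_n$ in the statement, but in $G$ in [f]. *)
have SV i : phi (tvb_sigma i)^-1%g = (S i)^-1%g by apply: gmulfV_group.
exists Phi; split.
- by split.
- by move=> i; rewrite SV; split; apply: Phi_gen.
- by move=> i; apply: Phi_gen.
- by move=> i; rewrite SV; apply: Phi_gen.
- by move=> j; apply: Phi_gen.
Qed.
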